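(* Let $q$ be an indeterminate and let $m$ and $l$ be two positive integers satisfying $m\geq l$. Then $$\sum_{i=0}^{\min\{l,m-l\}} (-1)^{i}q^{-i}\,\frac{[m-i]_{q}!}{[i]_{q}!\,[l-i]_{q}!\,[m-l-i]_{q}!}=q^{l(m-l)}$$ is a polynomial identity, i.e. it holds identically in the indeterminate $q$ (as an identity of Laurent polynomials in $q$).
   Context: For an integer $r$, $[r]_q=\dfrac{q^{r}-q^{-r}}{q-q^{-1}}$. For a positive integer $r$, $[r]_q!=\prod_{s=1}^{r}[s]_q$, and $[0]_q!=1$. *)

(* Defs.v *)
From HB Require Import structures.
From mathcomp Require Import all_boot all_order all_algebra.

Set Implicit Arguments.
Unset Strict Implicit.
Unset Printing Implicit Defensive.

Import Order.TTheory GRing.Theory Num.Theory.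
Local Open Scope ring_scope.

(* The Laurent polynomials in q embed in this field of rational functions, and
   the quotients of q-factorials are taken there. *)
Definition ratfun : fieldType := {fraction {poly rat}}.

Definition q : ratfun := tofrac 'X.

Definition qint (r : int) : ratfun := (q ^ r - q ^ (- r)) / (q - q^-1).

(* The product is empty, hence equal to 1, for n = 0. *)
Definition qfact (n : nat) : ratfun := \prod_(1 <= s < n.+1) qint s%:Z.

(* Main.v *)
(* With n = m - l, the sum S(l) equals q^(l n) because S(0) = 1 and
   S(l+1) = q^n S(l).  The latter telescopes: if t(l, i) denotes the i-th
   summand, then t(l+1, i) - q^n t(l, i) = G(i+1) - G(i), where
     G(i) = (-1)^(i+1) q^-(l+1) [i] [l+n+1-i]!
              / ([l+1] [i]! [l+1-i]! [n-i]!)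
   vanishes at i = 0 and at i = n+1; this rests on
   [a+b] = q^b [a] + q^-a [b] and [a-i][b-i] + [i][a+b-i] = [a][b]. *)
Require Import Defs.
From HB Require Import structures.
From mathcomp Require Import all_boot all_order all_algebra.
From mathcomp Require Import zify ring.

Set Implicit Arguments.
Unset Strict Implicit.
Unset Printing Implicit Defensive.

Import Order.TTheory GRing.Theory Num.Theory.
Local Open Scope ring_scope.

Section FieldIdentities.

Variable F : fieldType.
Implicit Types x y z w : F.

(** With [x] = q^a, [y] = q^b and [w] = q - q^-1 this is the addition rule for [a+b]. Powers of q
    become atoms, so that [field] can decide it. *)
Lemma bracketD x y w : x != 0 -> y != 0 -> w != 0 ->
  (x * y - (x * y)^-1) / w = y * ((x - x^-1) / w) + x^-1 * ((y - y^-1) / w).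
Proof. by move=> x0 y0 w0; field; rewrite x0 y0 w0. Qed.

Lemma bracket_mulBB x y z w : x != 0 -> y != 0 -> z != 0 -> w != 0 ->
  (x / z - (x / z)^-1) / w * ((y / z - (y / z)^-1) / w)
  + (z - z^-1) / w * ((x * y / z - (x * y / z)^-1) / w)
  = (x - x^-1) / w * ((y - y^-1) / w).
Proof. by move=> x0 y0 z0 w0; field; rewrite x0 y0 z0 w0. Qed.

(** The telescoping step with [s] = [l+1+n-i], [a] = [l+1-i], [b] = [n-i], [L] = [l+1], [I] = [i+1],
    [N] = [n], [j] = [i], [f] = [i]!, [A] = [l+n-i]!, [C] = 1/[l+1-i]!, [D] = 1/[n-i]!, [y] =
    q^(l+1), [x] = q^i, [z] = q^n, [e] = (-1)^i. *)
Lemma telescope_identity (s a b L I N j f A C D y x z e : F) :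
  s = z * a + y^-1 * x * N -> a * b + j * s = L * N ->
  L != 0 -> I != 0 -> f != 0 -> y != 0 -> x != 0 ->
  e * x^-1 * (A * s / f * C * D) - z * (e * x^-1 * (A / f * (a * C) * D))
  = - (-1 * e) * y^-1 / L * (I * A / (f * I) * (a * C) * (b * D))
    - - e * y^-1 / L * (j * (A * s) / f * C * D).
Proof.
move=> eB eC L0 I0 f0 y0 x0.
transitivity (e * x^-1 * A / f * C * D * (s - z * a)).
  by field; rewrite x0 f0.
(* Both brackets are multiples of [N]: s - z a = y^-1 x N and a b + j s = L N. *)
transitivity (e * y^-1 / L * A / f * C * D * (a * b + j * s)).
  by rewrite eC eB; field; rewrite x0 y0 L0 f0.
by field; rewrite y0 L0 f0 I0.
Qed.

End FieldIdentities.

Lemma q_neq0 : q != 0.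
Proof. by rewrite tofrac_eq0 polyX_eq0. Qed.

Lemma qX_neq1 n : (0 < n)%N -> q ^+ n != 1.
Proof.
move=> n_gt0; rewrite -tofracXn -tofrac1 tofrac_eq.
apply/eqP => /(congr1 (fun p : {poly rat} => size p)).
by rewrite size_polyXn size_poly1; case: n n_gt0.
Qed.

Lemma qz_subV_neq0 n : (0 < n)%N -> q ^ n%:Z - (q ^ n%:Z)^-1 != 0.
Proof.
move=> n_gt0; have qn0 : q ^ n%:Z != 0 by rewrite expfz_neq0 ?q_neq0.
(* If q^n equals its inverse, then q^(n+n) = 1. *)
rewrite subr_eq0; apply: contra_neqN (@qX_neq1 (n + n) _) => [/eqP e|].
  by rewrite exprD; move: e; rewrite -exprnP => {1}->; rewrite mulVf.
by rewrite addn_gt0 n_gt0.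
Qed.

Lemma q_subV_neq0 : q - q^-1 != 0.
Proof. exact: (@qz_subV_neq0 1). Qed.

Lemma qintE r : qint r = (q ^ r - (q ^ r)^-1) / (q - q^-1).
Proof. by rewrite /qint invr_expz. Qed.

Lemma qint0 : qint 0 = 0.
Proof. by rewrite /qint oppr0 subrr mul0r. Qed.

Lemma qint_neq0 n : (0 < n)%N -> qint n%:Z != 0.
Proof.
move=> n_gt0; rewrite qintE; apply: mulf_neq0; first exact: qz_subV_neq0.
by apply: invr_neq0; exact: q_subV_neq0.
Qed.

Lemma qintD a b : qint (a + b) = q ^ b * qint a + q ^ (- a) * qint b.
Proof.
rewrite !qintE expfzDr ?q_neq0 // -invr_expz.
apply: bracketD (expfz_neq0 a q_neq0) (expfz_neq0 b q_neq0) q_subV_neq0.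
Qed.

Lemma qint_mulBB a b i :
  qint (a - i) * qint (b - i) + qint i * qint (a + b - i) = qint a * qint b.
Proof.
rewrite !qintE !expfzDr ?q_neq0 // -invr_expz.
exact: bracket_mulBB (expfz_neq0 a q_neq0) (expfz_neq0 b q_neq0)
  (expfz_neq0 i q_neq0) q_subV_neq0.
Qed.

Lemma qfact0 : qfact 0 = 1.
Proof. by rewrite /qfact big_geq. Qed.

Lemma qfactS n : qfact n.+1 = qfact n * qint n.+1%:Z.
Proof. by rewrite /qfact big_nat_recr. Qed.

Lemma qfact_neq0 n : qfact n != 0.
Proof.
elim: n => [|n IHn]; first by rewrite qfact0 oner_neq0.
by rewrite qfactS mulf_neq0 ?qint_neq0.
Qed.

(* 1/[n-i]!, with the convention that 1/[r]! = 0 for negative r. *)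
Definition qfactBV (n i : nat) : ratfun :=
  if (i <= n)%N then (qfact (n - i))^-1 else 0.

Lemma qfactBV_gt n i : (n < i)%N -> qfactBV n i = 0.
Proof. by rewrite /qfactBV ltnNge => /negbTE ->. Qed.

Lemma qfactBVSS n i : qfactBV n.+1 i.+1 = qfactBV n i.
Proof. by rewrite /qfactBV ltnS subSS. Qed.

(** No bound on [i] is required: at i = n the factor [0] matches the convention, and beyond n both
    sides are 0. *)
Lemma qfactBVS n i : qfactBV n i.+1 = qint (n%:Z - i%:Z) * qfactBV n i.
Proof.
rewrite /qfactBV; case: (ltngtP i n) => [lt_in|_|->].
- rewrite subzn 1?ltnW // -(subnSK lt_in) qfactS invfM mulrCA mulfV ?mulr1 //.
  exact: qint_neq0.
- by rewrite mulr0.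
- by rewrite subrr qint0 mul0r.
Qed.

(** The summand t(l, i); it is 0 for i > l, so i can run up to n whatever l is. *)
Definition qterm (n l i : nat) : ratfun :=
  (-1) ^+ i * q ^- i
  * (qfact (l + n - i) * (qfact i)^-1 * qfactBV l i * qfactBV n i).

Definition qcert (n l i : nat) : ratfun :=
  - (-1) ^+ i * (q ^+ l.+1)^-1 / qint l.+1%:Z
  * (qint i%:Z * qfact (l.+1 + n - i)
     * (qfact i)^-1 * qfactBV l.+1 i * qfactBV n i).

Lemma qterm_telescope n l i : (i <= n)%N ->
  qterm n l.+1 i - q ^+ n * qterm n l i = qcert n l i.+1 - qcert n l i.
Proof.
move=> le_in.
have lS0 := @qint_neq0 l.+1 isT; have iS0 := @qint_neq0 i.+1 isT.
have i0 := qfact_neq0 i.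
have eA : qfact (l.+1 + n - i)
    = qfact (l + n - i) * qint (l.+1%:Z + n%:Z - i%:Z).
  (* The bound i <= n keeps the truncated subtraction exact. *)
  have -> : (l.+1 + n - i = (l + n - i).+1)%N by lia.
  by rewrite qfactS; congr (_ * qint _); lia.
have eB : qint (l.+1%:Z + n%:Z - i%:Z) =
    q ^+ n * qint (l.+1%:Z - i%:Z) + (q ^+ l.+1)^-1 * q ^+ i * qint n%:Z.
  have -> : l.+1%:Z + n%:Z - i%:Z = (l.+1%:Z - i%:Z) + n%:Z by lia.
  rewrite qintD opprB -exprnP expfzDr ?q_neq0 // -invr_expz -!exprnP.
  by rewrite [q ^+ i * _]mulrC.
have eC := qint_mulBB l.+1%:Z n%:Z i%:Z.
have eD : (l.+1 + n - i.+1 = l + n - i)%N by lia.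
(* Reading 1/[l-i]! as 1/[(l+1)-(i+1)]! lets all four terms be expressed through 1/[l+1-i]! and
   1/[n-i]!. *)
rewrite /qterm /qcert eD eA -(qfactBVSS l i) !(qfactBVS _ i) qfactS.
have ql0 : q ^+ l.+1 != 0 by rewrite expf_neq0 ?q_neq0.
have qi0 : q ^+ i != 0 by rewrite expf_neq0 ?q_neq0.
rewrite [(-1) ^+ i.+1]exprS.
exact: telescope_identity eB eC lS0 iS0 i0 ql0 qi0.
Qed.

Lemma sum_qtermS n l :
  \sum_(0 <= i < n.+1) qterm n l.+1 i
  = q ^+ n * \sum_(0 <= i < n.+1) qterm n l i.
Proof.
apply/eqP; rewrite -subr_eq0 big_distrr -sumrB /=; apply/eqP.
rewrite (eq_big_nat _ _ (F2 := fun i => qcert n l i.+1 - qcert n l i)).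
  rewrite telescope_sumr // /qcert (qfactBV_gt (n := n)) //.
  by rewrite [qint 0%N%:Z]qint0 !(mulr0, mul0r) subrr.
by move=> i; rewrite ltnS => /qterm_telescope ->.
Qed.

Lemma sum_qterm n l : \sum_(0 <= i < n.+1) qterm n l i = q ^+ (l * n).
Proof.
elim: l => [|l IHl]; last by rewrite sum_qtermS IHl -exprD mulSn.
(* For l = 0 only i = 0 survives, with value [n]!/[n]!. *)
rewrite big_nat_recl // big1 => [|i _]; last first.
  by rewrite /qterm (qfactBV_gt (n := 0)) // !(mulr0, mul0r).
rewrite /qterm /qfactBV /= !subn0 add0n qfact0 mul0n !expr0 invr1 !mulr1 !mul1r.
by rewrite addr0 mulfV ?qfact_neq0.
Qed.

Theorem theorem2p1 (m l : nat) (m_gt0 : (0 < m)%N) (l_gt0 : (0 < l)%N)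
    (le_lm : (l <= m)%N) :
  \sum_(0 <= i < (minn l (m - l)).+1)
     (-1) ^+ i * q ^- i
       * (qfact (m - i) / (qfact i * qfact (l - i) * qfact (m - l - i)))
  = q ^+ (l * (m - l)).
Proof.
rewrite -sum_qterm [RHS](big_cat_nat (n := (minn l (m - l)).+1)) //=; last first.
  by rewrite ltnS geq_minr.
(* The added terms have min(l, m-l) < i <= m-l, hence i > l, and vanish through 1/[l-i]! = 0. *)
rewrite [X in _ + X]big_nat [X in _ + X]big1 ?addr0 => [|i /andP[lt_i lt_in]].
  apply: eq_big_nat => i /=; rewrite ltnS leq_min => /andP[le_il le_in].
  by rewrite /qterm /qfactBV le_il le_in subnKC // !invfM !mulrA.
rewrite /qterm (qfactBV_gt (n := l)) ?(mulr0, mul0r) //.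
lia.
Qed.
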